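(* Let $a<0$, $b\in\mathbb{R}$, $c=-b/a$, let $F=F_{a,b}$ with $F_{a,b}(x,y)=(|x|-y+a,\;x-|y|+b)$, and let $\Gamma=\Gamma_{a,b}$ be its compact invariant graph. Suppose that $c<-2$ or $c\in[-112/137,-13/16]\cup[603/874,563/816]$. Then there is a set $E\subset\Gamma$ of full (one-dimensional) Lebesgue measure in $\Gamma$ such that the collection $\{\omega(\mathbf{x}):\mathbf{x}\in E\}$ of $\omega$-limit sets under $F$ has at most three elements. Moreover, if $b/a\in\mathbb{Q}$, these $\omega$-limit sets are periodic orbits.
   Context: $\omega(\mathbf{x})$ is the set of accumulation points of the forward orbit $(F^n(\mathbf{x}))_{n\ge0}$. $\overline{PQ}$ is the closed segment with endpoints $P,Q$. Lebesgue measure on $\Gamma$ is arc length on its edges. For $a<0$ the map $F_{a,b}$ has a compact invariant graph $\Gamma_{a,b}$ which eventually captures all orbits apart from those landing on certain exceptional periodic points. Since $\lambda F_{a,b}(x/\lambda,y/\lambda)=F_{\lambda a,\lambda b}(x,y)$ for $\lambda>0$, one has $\Gamma_{a,b}=|a|\,\Gamma_{-1,c}$ with $c=-b/a$. The graph $\Gamma_{-1,c}$ is, in the relevant ranges (writing $\beta$ for the value $c$): (i) For $\beta<-2$: the closed polygonal curve with consecutive vertices $P_1,P_2,P_3,P_4,P_5,P_6,R_2,P_1$, where $P_1=(-\beta-2,-1)$, $P_2=(-\beta-2,-3)$, $P_3=(-\beta,-5)$, $P_4=(-\beta+4,-5)$, $P_5=(-\beta+8,-1)$, $P_6=(-\beta+8,7)$,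 $R_2=(-\beta+7,8)$. (ii) For $\beta\in[-112/137,-13/16]$: the union of $\overline{P_2T_2}$, $\overline{P_2R_2}$, $\overline{R_2P_3}$, $\overline{R_3P_4}$, $\overline{R_4P_5}$, $\overline{R_5P_6}$, $\overline{R_6T_2}$, where $P_2=(-\beta-2,-1)$, $P_3=(\beta+2,-3)$, $P_4=(\beta+4,2\beta-1)$, $P_5=(-\beta+4,4\beta+3)$, $P_6=(-5\beta,4\beta+7)$, $R_2=(\beta,-1)$, $R_3=(-\beta,2\beta-1)$, $R_4=(-3\beta,2\beta-1)$, $R_5=(-5\beta,-1)$, $R_6=(-5\beta,-4\beta-1)$, $T_2=(-5\beta-1,-4\beta)$. (iii) For $\beta\in[603/874,563/816]$: the union of $\overline{P_4R_2}$, $\overline{P_1R_3}$, $\overline{P_2X_3}$, $\overline{X_2R_4}$, $\overline{P_3X_3}$, $\overline{R_5X_4}$, $\overline{R_2X_4}$, $\overline{R_6T_2}$, $\overline{R_3X_5}$, $\overline{R_4X_6}$, $\overline{R_5Z_2}$, $\overline{Z_2X_7}$, $\overline{R_6Z_3}$, $\overline{Z_3Y_2}$, where $P_1=(-\beta-2,-1)$, $P_2=(\beta+2,-3)$, $P_3=(\beta+4,2\beta-1)$, $P_4=(-\beta+4,5)$, $R_2=(-2\beta,1-\beta)$, $R_3=(3\beta-2,-1)$, $R_4=(3\beta-2,4\beta-3)$, $R_5=(-\beta,8\beta-5)$, $R_6=(-7\beta+4,-8\beta+5)$, $T_2=(\beta-1,0)$, $X_2=(0,\beta-1)$, $X_3=(-\beta,2\beta-1)$,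 $X_4=(-\beta,1-2\beta)$, $X_5=(3\beta-2,1-2\beta)$, $X_6=(5\beta-4,2\beta-1)$, $X_7=(-7\beta+4,4\beta-3)$, $Y_2=(7\beta-5,-6\beta+4)$, $Z_2=(-7\beta+4,8\beta-5)$, $Z_3=(-\beta,9-14\beta)$. *)

(* Defs.v *)
From HB Require Import structures.
From mathcomp Require Import all_boot all_order all_algebra.
From mathcomp Require Import all_classical all_reals all_analysis.

Set Implicit Arguments.
Unset Strict Implicit.
Unset Printing Implicit Defensive.

Import Order.TTheory GRing.Theory Num.Theory.
Import numFieldNormedType.Exports.

Local Open Scope classical_set_scope.
Local Open Scope ring_scope.

Definition F (R : realType) (a b : R) (p : R * R) : R * R :=
  (`|p.1| - p.2 + a, p.1 - `|p.2| + b).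

(* Accumulation points of the sequence n |-> f^n x (not of its range): a point
   visited infinitely often belongs to the omega-limit set. *)
Definition omega_limit (T : topologicalType) (f : T -> T) (x : T) : set T :=
  cluster ((fun n : nat => iter n f x) @ \oo).

Definition is_periodic_orbit (T : Type) (f : T -> T) (A : set T) : Prop :=
  exists (p : T) (n : nat),
    [/\ (0 < n)%N, iter n f p = p & A = range (fun k : nat => iter k f p)].

(* An edge is the pair of the endpoints of a closed segment. *)
Definition edge (R : realType) : Type := ((R * R) * (R * R))%type.

Definition edge_point (R : realType) (e : edge R) (t : R) : R * R :=
  ((1 - t) * e.1.1 + t * e.2.1, (1 - t) * e.1.2 + t * e.2.2).

Definition segment (R : realType) (e : edge R) : set (R * R) :=
  edge_point e @` [set t | 0 <= t <= 1].

Definition edge_length (R : realType) (e : edge R) : R :=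
  Num.sqrt ((e.2.1 - e.1.1) ^+ 2 + (e.2.2 - e.1.2) ^+ 2).

Definition graph_of (R : realType) (es : seq (edge R)) : set (R * R) :=
  [set p | exists2 e, e \in es & segment e p].

(* A is null for arc length on the graph: on every edge, its trace is Lebesgue
   null in the arc-length parameter s. *)
Definition arc_length_null (R : realType) (es : seq (edge R))
    (A : set (R * R)) : Prop :=
  forall e, e \in es ->
    (@lebesgue_measure R).-negligible
      [set s | 0 <= s <= edge_length e /\ A (edge_point e (s / edge_length e))].

Definition edges_i (R : realType) (c : R) : seq (edge R) :=
  let P1 := (- c - 2, - 1) in
  let P2 := (- c - 2, - 3) in
  let P3 := (- c, - 5) in
  let P4 := (- c + 4, - 5) in
  let P5 := (- c + 8, - 1) in
  let P6 := (- c + 8, 7) in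
  let R2 := (- c + 7, 8) in
  [:: (P1, P2); (P2, P3); (P3, P4); (P4, P5); (P5, P6); (P6, R2); (R2, P1)].

Definition edges_ii (R : realType) (c : R) : seq (edge R) :=
  let P2 := (- c - 2, - 1) in
  let P3 := (c + 2, - 3) in
  let P4 := (c + 4, 2 * c - 1) in
  let P5 := (- c + 4, 4 * c + 3) in
  let P6 := (- 5 * c, 4 * c + 7) in
  let R2 := (c, - 1) in
  let R3 := (- c, 2 * c - 1) in
  let R4 := (- 3 * c, 2 * c - 1) in
  let R5 := (- 5 * c, - 1) in
  let R6 := (- 5 * c, - 4 * c - 1) in
  let T2 := (- 5 * c - 1, - 4 * c) in
  [:: (P2, T2); (P2, R2); (R2, P3); (R3, P4); (R4, P5); (R5, P6); (R6, T2)].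

Definition edges_iii (R : realType) (c : R) : seq (edge R) :=
  let P1 := (- c - 2, - 1) in
  let P2 := (c + 2, - 3) in
  let P3 := (c + 4, 2 * c - 1) in
  let P4 := (- c + 4, 5) in
  let R2 := (- 2 * c, 1 - c) in
  let R3 := (3 * c - 2, - 1) in
  let R4 := (3 * c - 2, 4 * c - 3) in
  let R5 := (- c, 8 * c - 5) in
  let R6 := (- 7 * c + 4, - 8 * c + 5) in
  let T2 := (c - 1, 0) in
  let X2 := (0, c - 1) in
  let X3 := (- c, 2 * c - 1) in
  let X4 := (- c, 1 - 2 * c) in
  let X5 := (3 * c - 2, 1 - 2 * c) in
  let X6 := (5 * c - 4, 2 * c - 1) in
  let X7 := (- 7 * c + 4, 4 * c - 3) in
  let Y2 := (7 * c - 5, - 6 * c + 4) in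
  let Z2 := (- 7 * c + 4, 8 * c - 5) in
  let Z3 := (- c, 9 - 14 * c) in
  [:: (P4, R2); (P1, R3); (P2, X3); (X2, R4); (P3, X3); (R5, X4); (R2, X4);
      (R6, T2); (R3, X5); (R4, X6); (R5, Z2); (Z2, X7); (R6, Z3); (Z3, Y2)].

(* Edges of the invariant graph of F (-1) c; the value [::] outside the three
   parameter ranges is a dummy. *)
Definition unit_edges (R : realType) (c : R) : seq (edge R) :=
  if c < - 2 then edges_i c
  else if - (112 / 137) <= c <= - (13 / 16) then edges_ii c
  else if 603 / 874 <= c <= 563 / 816 then edges_iii c
  else [::].

Definition scale_edge (R : realType) (k : R) (e : edge R) : edge R :=
  ((k * e.1.1, k * e.1.2), (k * e.2.1, k * e.2.2)).

(* The conjugacy by scaling carries F (-1) (- b / a) to F a b, for a < 0. *)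
Definition Gamma_edges (R : realType) (a b : R) : seq (edge R) :=
  [seq scale_edge `|a| e | e <- unit_edges (- b / a)].

Definition Gamma (R : realType) (a b : R) : set (R * R) :=
  graph_of (Gamma_edges a b).

(* Main.v *)
(* On the part of an edge lying in a closed quadrant, F is affine. In the first
   quadrant it collapses segments of slope 1, and in the third one segments of
   slope -1, to a point; on every other piece of an edge it multiplies the
   natural coordinate by a factor 1 or 2 and lands on another edge. Let K be the
   set of points whose orbit never meets a finite set V of values of the
   collapsed pieces. Since F maps K into itself, the lengths of the traces of K
   on the pieces of the edges satisfy a system of linear inequalities, and this
   system forces all of them to vanish. So almost every orbit meets V, and its
   omega-limit set is that of a point of V; one, two or three points suffice.
   If c is rational, V lies in a lattice preserved by F; its orbits remain in
   the bounded graph, hence are eventually periodic. *)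
Require Import Defs.
From mathcomp Require Import all_boot all_order all_algebra.
From mathcomp Require Import all_classical all_reals all_analysis.
From mathcomp Require Import ring lra zify.
Import Order.TTheory GRing.Theory Num.Theory.
Import numFieldNormedType.Exports.
Local Open Scope classical_set_scope.
Local Open Scope ring_scope.
Local Open Scope card_scope.

Set Implicit Arguments.
Unset Strict Implicit.

(** * Lebesgue measure under affine maps of the line *)

Lemma preimage_affine_itv (R : realFieldType) (k d a b : R) : 0 < k ->
  (fun t => k * t + d) @^-1` `]a, b]%classic
    = `](a - d) / k, (b - d) / k]%classic.
Proof.
move=> k0; apply/seteqP; split=> t /=; rewrite !in_itv/=.
  by rewrite ltr_pdivrMr// ler_pdivlMr// (mulrC t) ltrBlDr lerBrDr.
by rewrite ltr_pdivrMr// ler_pdivlMr// (mulrC t) ltrBlDr lerBrDr.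
Qed.

Lemma preimage_affine_itv_lt0 (R : realFieldType) (k d a b : R) : k < 0 ->
  (fun t => k * t + d) @^-1` `]a, b]%classic
    = `[(b - d) / k, (a - d) / k[%classic.
Proof.
move=> k0; apply/seteqP; split=> t /=; rewrite !in_itv/=.
  by rewrite ltr_ndivlMr// ler_ndivrMr// (mulrC t) ltrBlDr lerBrDr andbC.
by rewrite ltr_ndivlMr// ler_ndivrMr// (mulrC t) ltrBlDr lerBrDr andbC.
Qed.

Section affine_measure.
Local Open Scope ereal_scope.
Context (R : realType).
Local Notation mu := (@lebesgue_measure R).

Lemma measurable_affine (k d : R) :
  measurable_fun [set: measurableTypeR R]
    ((fun t => (k * t + d)%R) : measurableTypeR R -> measurableTypeR R).
Proof. exact: measurable_realfun.measurable_funD. Qed.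

(** Lebesgue measure is determined by its values on half-open intervals, and the pushforward scaled
    by [|k|] has the same ones. For [k < 0] the preimage of such an interval is half-open on the
    other side, which leaves its length unchanged. *)
Lemma lebesgue_measure_affine (k d : R) (A : set R) : (k != 0)%R ->
  measurable A ->
  (`|k|%R)%:E * mu ((fun t => (k * t + d)%R) @^-1` A) = mu A.
Proof.
move=> k0 mA.
have mf := measurable_affine k d.
have kp : (0 <= `|k|)%R by [].
pose m := mscale (NngNum kp)
  (pushforward mu ((fun t => (k * t + d)%R) : measurableTypeR R -> measurableTypeR R)).
suff : mu A = m mf A by move->.
apply: lebesgue_measure_unique => //= _ [[a b]] _ <-.
rewrite [RHS](_ : _ = (`|k|%R)%:E *
  mu ((fun t => (k * t + d)%R) @^-1` `]a, b]%classic))//.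
have [k_lt0|k_gt0|k_eq0] := ltgtP k 0%R; last by rewrite k_eq0 eqxx in k0.
  rewrite preimage_affine_itv_lt0// !lebesgue_measure_itv/= !lte_fin.
  rewrite ltr_ndivrMr// divfK// ltrD2r.
  case: ifPn => ab; last by rewrite mule0.
  rewrite -!EFinD -EFinM; congr EFin.
  by rewrite ltr0_norm//; field.
rewrite preimage_affine_itv// !lebesgue_measure_itv/= !lte_fin.
rewrite ltr_pdivrMr// divfK// ltrD2r.
case: ifPn => ab; last by rewrite mule0.
rewrite -!EFinD -EFinM; congr EFin.
by rewrite gtr0_norm//; field.
Qed.
End affine_measure.

(** * Measure of the traces on lines of the points whose orbit avoids V *)

(* A line is the pair of a base point and a direction. *)
Definition line (R : realType) (l : (R * R) * (R * R)) (t : R) : R * R :=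
  (l.1.1 + t * l.2.1, l.1.2 + t * l.2.2).

Definition avoids (T : eqType) (f : T -> T) (V : seq T) : set T :=
  [set p | forall n, iter n f p \notin V].

Lemma avoids_step (T : eqType) (f : T -> T) (V : seq T) (p : T) :
  avoids f V p -> avoids f V (f p).
Proof. by move=> Kp n; rewrite -iterSr; exact: Kp. Qed.

Section mass.
Context (R : realType) (a b : R) (V : seq (R * R)).
Local Notation mu := (@lebesgue_measure R).
Local Notation K := (avoids (F a b) V).
Implicit Types (l : (R * R) * (R * R)) (t k d : R).

Lemma measurable_iter_F l n :
  measurable_fun [set: R] (fun t => (iter n (F a b) (line l t)).1) /\
  measurable_fun [set: R] (fun t => (iter n (F a b) (line l t)).2).
Proof.
elim: n => [|n [IH1 IH2]] /=.
  by split; apply: measurable_realfun.measurable_funD => //;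
    apply: measurable_realfun.measurable_funM.
split; apply: measurable_realfun.measurable_funD => //.
  by apply: measurable_realfun.measurable_funB => //; exact: measurableT_comp.
by apply: measurable_realfun.measurable_funB => //; exact: measurableT_comp.
Qed.

(** The trace is a countable intersection, over times and points of [V], of complements of preimages
    of points under the coordinates of the iterates, which are measurable functions on the line. *)
Lemma measurable_avoids l : measurable (line l @^-1` K).
Proof.
rewrite (_ : _ @^-1` _ = \bigcap_n \bigcap_(v in [set` V])
  ~` ((fun t => (iter n (F a b) (line l t)).1) @^-1` [set v.1] `&`
      (fun t => (iter n (F a b) (line l t)).2) @^-1` [set v.2])); last first.
  apply/seteqP; split => t /= Kt.
    move=> n _ v vV /= [e1 e2]; have /negP := Kt n; apply.
    by rewrite (surjective_pairing (iter _ _ _)) e1 e2 -surjective_pairing.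
  by move=> n; apply/negP => nV; apply: (Kt n I _ nV).
apply: bigcapT_measurable => n; apply: fin_bigcap_measurable => // v _.
have [m1 m2] := measurable_iter_F l n.
apply: measurableC; apply: measurableI; rewrite -[X in measurable X]setTI.
  exact: m1.
exact: m2.
Qed.

(** The interval is bounded, so [fine] discards no infinite value; real values allow the
    inequalities between masses to be solved by linear arithmetic. *)
Definition mass l (al be : R) : R :=
  fine (mu (`[al, be]%classic `&` line l @^-1` K)).

Lemma measurable_mass l al be :
  measurable (`[al, be]%classic `&` line l @^-1` K).
Proof. by apply: measurableI => //; exact: measurable_avoids. Qed.

Lemma massE l al be :
  mu (`[al, be]%classic `&` line l @^-1` K) = (mass l al be)%:E.
Proof.
rewrite fineK// ge0_fin_numE//.
apply: (@le_lt_trans _ _ (mu `[al, be]%classic)).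
  by apply: le_measure; rewrite ?inE//; exact: measurable_mass.
by rewrite lebesgue_measure_itv/=; case: ifP => _; rewrite ?ltry// ltry.
Qed.

Lemma mass_ge0 l al be : 0 <= mass l al be.
Proof. exact: fine_ge0. Qed.

(** Only an inequality is claimed, so the three parameters may come in any order and the cut point
    may be counted twice. *)
Lemma mass_split l al ga be : mass l al be <= mass l al ga + mass l ga be.
Proof.
rewrite -lee_fin EFinD -!massE.
apply: le_trans (measureU2 _ _ _); [|exact: measurable_mass..].
apply: le_measure; rewrite ?inE; first exact: measurable_mass.
  by apply: measurableU; exact: measurable_mass.
move=> t [/=]; rewrite in_itv/= => /andP[at_ tb] Kt.
by have [tg|tg] := leP t ga; [left|right];
  split => //=; rewrite in_itv/= ?at_ ?tb ?tg ?(ltW tg).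
Qed.

Lemma mass_eq0 l al be :
  (forall t, al <= t <= be -> exists n, iter n (F a b) (line l t) \in V) ->
  mass l al be = 0.
Proof.
move=> H; rewrite /mass (_ : _ `&` _ = set0) ?measure0//.
apply/seteqP; split => // t [/=]; rewrite in_itv/= => /H[n nV] /(_ n).
by rewrite nV.
Qed.

(* The inclusion behind it is the forward invariance of [avoids]. *)
Lemma mass_affine l al be l' al' be' k d : k != 0 ->
  (forall t, al <= t <= be ->
    F a b (line l t) = line l' (k * t + d) /\ al' <= k * t + d <= be') ->
  `|k| * mass l al be <= mass l' al' be'.
Proof.
move=> k0 H; rewrite -lee_fin EFinM -!massE.
rewrite -(lebesgue_measure_affine d k0 (measurable_mass l' al' be')).
apply: lee_pmul => //; apply: le_measure; rewrite ?inE.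
- exact: measurable_mass.
- rewrite -[X in measurable X]setTI.
  by apply: (measurable_affine k d) => //; exact: measurable_mass.
- move=> t [/=]; rewrite !in_itv/= => tab Kt; have [e tab'] := H _ tab.
  by split => //; rewrite /= -e; exact: avoids_step.
Qed.

End mass.

(** * Omega-limit sets of eventually periodic points *)

Lemma omega_limit_iter (T : topologicalType) (f : T -> T) (x : T) (m : nat) :
  omega_limit f (iter m f x) = omega_limit f x.
Proof.
rewrite /omega_limit (_ : (fun n => iter n f (iter m f x)) =
  (fun n => iter n f x) \o addn^~ m); last first.
  by apply/funext => n /=; rewrite iterD.
apply/seteqP; split => p.
  move=> cp A B [N _ NA] nB; apply: cp => //; exists N => // n /= Nn.
  by apply: NA; exact: leq_trans Nn (leq_addr _ _).
move=> cp A B [N _ NA] nB; apply: cp => //; exists (N + m)%N => // n /= Nn.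
have -> : n = ((n - m) + m)%N by rewrite subnK// (leq_trans _ Nn)// leq_addl.
by apply: NA => /=; rewrite leq_subRL ?(leq_trans _ Nn) ?leq_addl// addnC.
Qed.

Lemma iter_modn (T : Type) (f : T -> T) (p : T) (n k : nat) :
  iter n f p = p -> iter k f p = iter (k %% n)%N f p.
Proof.
move=> np; rewrite [in LHS](divn_eq k n) addnC iterD; congr (iter _ f _).
by elim: (k %/ n)%N => [//|q IH]; rewrite mulSn iterD IH np.
Qed.

(** The orbit is finite, hence closed, so it contains all accumulation points; conversely every
    point of it recurs at arbitrarily late times. *)
Lemma omega_limit_periodic (T : topologicalType) (f : T -> T) (p : T) (n : nat) :
  hausdorff_space T -> (0 < n)%N -> iter n f p = p ->
  omega_limit f p = range (fun k => iter k f p).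
Proof.
move=> hT n0 np; apply/seteqP; split => [q cq|_ [k _ <-] A B [N _ NA] nB].
  have fin : finite_set (range (fun k => iter k f p)).
    apply: (@sub_finite_set _ _ ((fun k => iter k f p) @` `I_n)).
      by move=> _ [k _ <-]; exists (k %% n)%N; rewrite /= ?ltn_mod// -iter_modn.
    exact/finite_image/finite_II.
  have /accessible_finite_set_closed/(_ _ fin) cl := hausdorff_accessible hT.
  apply: cl => B nB; apply: cq => //.
  by exists 0%N => // k _; exists k.
(* Since [0 < n], the time [k + N * n] is at least [N], and it is congruent to [k] modulo [n]. *)
exists (iter (k + N * n) f p); split.
  by apply: NA => /=; rewrite (leq_trans _ (leq_addl _ _))// leq_pmulr.
rewrite (iter_modn _ np) addnC modnMDl.
by rewrite -(iter_modn _ np); exact: nbhs_singleton.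
Qed.

Definition eventually_periodic (T : Type) (f : T -> T) (x : T) :=
  exists i j, (i < j)%N /\ iter i f x = iter j f x.

Lemma omega_limit_eventually_periodic (T : topologicalType) (f : T -> T) (x : T) :
  hausdorff_space T -> eventually_periodic f x ->
  is_periodic_orbit f (omega_limit f x).
Proof.
move=> hT [i [j [ij e]]].
have per : iter (j - i) f (iter i f x) = iter i f x.
  by rewrite -iterD subnK ?(ltnW ij).
exists (iter i f x), (j - i)%N; split => //; first by rewrite subn_gt0.
rewrite -(omega_limit_iter f x i).
by apply: omega_limit_periodic per; rewrite ?subn_gt0.
Qed.

(** Pigeonhole: if no two iterates agreed, the orbit map would be injective from the naturals into a
    finite set. *)
Lemma finite_orbit_eventually_periodic (T : Type) (f : T -> T) (x : T) (A : set T) :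
  finite_set A -> (forall n, A (iter n f x)) -> eventually_periodic f x.
Proof.
move=> fA Ax; apply: contrapT => nper.
case: infinite_nat; rewrite (_ : setT = (fun n => iter n f x) @^-1` A).
  apply: finite_preimage => // i j _ _ eij.
  have [ij|ij|//] := ltngtP i j; exfalso; apply: nper.
    by exists i, j.
  by exists j, i.
by apply/seteqP; split => n // _; exact: Ax.
Qed.

(** * Rational parameters: orbits in a bounded part of a lattice *)

Definition lattice (R : realType) (D : R) : set (R * R) :=
  [set p | D * p.1 \is a Num.int /\ D * p.2 \is a Num.int].

(** [F] uses only sums, differences, absolute values and the constants [a], [b], all of which
    respect integrality after multiplication by [D]. *)
Lemma lattice_F (R : realType) (D a b : R) (p : R * R) : 0 <= D ->
  D * a \is a Num.int -> D * b \is a Num.int ->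
  lattice D p -> lattice D (F a b p).
Proof.
move=> D0 Da Db [Dx Dy].
have intn (x : R) : D * x \is a Num.int -> D * `|x| \is a Num.int.
  by move=> /natr_norm_int/intr_nat; rewrite normrM ger0_norm.
by split; rewrite /= mulrDr mulrBr rpredD ?rpredB ?intn.
Qed.

Lemma finite_lattice_box (R : realType) (D B : R) : 0 < D ->
  finite_set (lattice D `&` [set p | `|p.1| <= B /\ `|p.2| <= B]).
Proof.
(* An integer [D * x] with [|x| <= B] lies between [- M] and [M]; the shift by [M] indexes the
   possible coordinates by the naturals below [2 * M + 1]. *)
move=> D0; pose M := Num.trunc (D * B).
pose g (k : nat) : R := (k%:R - M%:R) / D.
have coord x : D * x \is a Num.int -> `|x| <= B -> exists2 k, (k < M.*2.+1)%N & x = g k.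
  move=> /intrP[m e] xB.
  have mM : (`|m| <= M)%N.
    rewrite /M truncn_ge_nat; last by rewrite mulr_ge0 ?(ltW D0) ?(le_trans _ xB).
    by rewrite -[(_ %:R)%R]/(`|m|%N%:~R) abszE intr_norm -e normrM (gtr0_norm D0) ler_pM2l.
  exists (absz (m + M%:Z)); first lia.
  rewrite /g -[(absz _)%:R]/((absz (m + M%:Z))%:~R) gez0_abs; last lia.
  by rewrite intrD addrK -e mulrAC divff ?gt_eqF// mul1r.
apply: (@sub_finite_set _ _ ((fun ij => (g ij.1, g ij.2)) @` (`I_(M.*2.+1) `*` `I_(M.*2.+1)))).
  move=> [x y] [[/= Dx Dy] [/= xB yB]].
  have [i iM ->] := coord _ Dx xB; have [j jM ->] := coord _ Dy yB.
  by exists (i, j).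
by apply: finite_image; apply: finite_setX; exact: finite_II.
Qed.

Lemma rational_orbit_eventually_periodic (R : realType) (D B a b : R) (S : set (R * R)) (p : R * R) :
  0 < D -> D * a \is a Num.int -> D * b \is a Num.int ->
  (forall q, S q -> S (F a b q)) ->
  (forall q, S q -> `|q.1| <= B /\ `|q.2| <= B) ->
  lattice D p -> S p -> eventually_periodic (F a b) p.
Proof.
move=> D0 Da Db SF SB Dp Sp.
apply: (finite_orbit_eventually_periodic (finite_lattice_box B D0)) => n.
have [Ln Sn] : lattice D (iter n (F a b) p) /\ S (iter n (F a b) p).
  elim: n => [//|n [IH1 IH2]]; split; last exact: SF.
  by apply: lattice_F => //; exact: ltW.
by split => //; exact: SB.
Qed.

(** * Reduction to a = -1 by scaling *)

Section reduction.
Context (R : realType).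

Definition scale (k : R) (p : R * R) : R * R := (k * p.1, k * p.2).

Lemma edge_point_scale (k : R) (e : edge R) (t : R) :
  edge_point (scale_edge k e) t = scale k (edge_point e t).
Proof. by rewrite /scale /edge_point /=; congr pair; ring. Qed.

Lemma edge_point_line (l : (R * R) * (R * R)) (u w t : R) :
  edge_point (line l u, line l w) t = line l (u + t * (w - u)).
Proof. by rewrite /line /edge_point /=; congr pair; ring. Qed.

Lemma iter_F_scale (k c : R) (p : R * R) n : 0 <= k ->
  iter n (F (- k) (k * c)) (scale k p) = scale k (iter n (F (- 1) c) p).
Proof.
move=> k0; elim: n => [//|n IH]; rewrite !iterS IH /F /scale /= !normrM ger0_norm//.
by congr pair; ring.
Qed.

(** The listed edges have either orientation, whereas the coordinate on an arc increases from [al]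
    to [be]. *)
Definition arc_of_edge (l : (R * R) * (R * R)) (al be : R) (e : edge R) : Prop :=
  al < be /\ (e = (line l al, line l be) \/ e = (line l be, line l al)).

(** The arc-length parameter and the coordinate on the line differ by a nonconstant affine map,
    which pulls null sets back to null sets. [L] is left free because it will be the length of the
    scaled edge, while [e] is an edge of the unit graph. *)
Lemma negligible_edge (c L : R) (V : seq (R * R)) l (al be : R) (e : edge R)
    (A : set R) : 0 <= L ->
  arc_of_edge l al be e -> mass (- 1) c V l al be = 0 ->
  (forall t, A t -> avoids (F (- 1) c) V (edge_point e t)) ->
  (@lebesgue_measure R).-negligible [set s | 0 <= s <= L /\ A (s / L)].
Proof.
move=> L0 [ab el] m0 AK.
(* If [L = 0], the only admissible [s] is 0. *)
have [L_eq0|L_neq0] := eqVneq L 0.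
  exists [set 0]; split => //; first exact: lebesgue_measure_set1.
  by move=> s /=; rewrite L_eq0 => -[]/andP[s0 s0'] _; apply/eqP; rewrite eq_le s0 s0'.
have Lgt0 : 0 < L by rewrite lt_neqAle eq_sym L_neq0.
(* [u] and [w] are the coordinates of the endpoints in the order chosen by the edge, so the slope
   [w - u] may be negative. *)
have [u [w [uw eE uwin]]] : exists u w, [/\ u != w, e = (line l u, line l w) &
    forall t, 0 <= t <= 1 -> al <= u + t * (w - u) <= be].
  case: el => ->; [exists al, be|exists be, al]; split => //;
    [by rewrite lt_eqF| |by rewrite gt_eqF|]; move=> t /andP[t0 t1]; nra.
have k0 : (w - u) / L != 0 by rewrite mulf_neq0 ?invr_neq0// subr_eq0 eq_sym.
set M := `[al, be]%classic `&` line l @^-1` avoids (F (- 1) c) V.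
have mM : measurable M by exact: measurable_mass.
pose g s := (w - u) / L * s + u.
have mg : measurable (g @^-1` M).
  rewrite -[X in measurable X]setTI.
  by apply: (measurable_affine ((w - u) / L) u).
exists (g @^-1` M); split => //.
  have /eqP := lebesgue_measure_affine u k0 mM.
  rewrite [X in _ == X]massE m0 mule_eq0 eqe normr_eq0 (negbTE k0)/=.
  by move=> /eqP.
move=> s /= [/andP[s0 sL] As].
have gE : g s = u + s / L * (w - u) by rewrite /g; ring.
split => /=.
  rewrite in_itv/= gE; apply: uwin.
  by rewrite divr_ge0//= ler_pdivrMr// mul1r.
by rewrite gE -edge_point_line -eE; exact: AK.
Qed.

Lemma card_le_nth (T : Type) (U : pointedType) (A : set T) (f : T -> U)
    (s : seq U) (n : nat) : (size s <= n)%N ->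
  (forall x, A x -> exists2 i, (i < size s)%N & f x = nth point s i) ->
  f @` A #<= `I_n.
Proof.
move=> sn H; apply: (@card_le_trans _ _ _ (nth point s @` `I_n)).
  apply: subset_card_le => _ [x /H[i si ->] <-]; exists i => //=.
  exact: leq_trans si sn.
exact: card_image_le.
Qed.

(** [E] consists of the points of [Gamma a b] whose orbit meets the scaled copy of [V]. Each limit
    set is then that of a scaled point of [V], and the rest of the graph consists of scaled points
    avoiding [V], which have mass zero on every edge. [D] stands for a denominator of [c]. *)
Lemma theorem3_from_unit (a b c : R) (V : seq (R * R)) :
  a < 0 -> c = - b / a -> (size V <= 3)%N ->
  (forall e, e \in unit_edges c -> exists l al be,
     arc_of_edge l al be e /\ mass (- 1) c V l al be = 0) ->
  (forall D, 0 < D -> D \is a Num.int -> D * c \is a Num.int ->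
     forall v, v \in V -> eventually_periodic (F (- 1) c) v) ->
  exists E : set (R * R),
    [/\ E `<=` Gamma a b,
        arc_length_null (Gamma_edges a b) (Gamma a b `\` E),
        [set omega_limit (F a b) x | x in E] #<= `I_3
      & (exists q : rat, b / a = ratr q) ->
        forall x : R * R, E x ->
          is_periodic_orbit (F a b) (omega_limit (F a b) x)].
Proof.
move=> a0 cE V3 Vnull Vper; pose k := - a.
have k0 : 0 < k by rewrite oppr_gt0.
have aE : a = - k by rewrite opprK.
have bE : b = k * c by rewrite cE /k; field; rewrite lt_eqF.
have iterE n p : iter n (F a b) (scale k p) = scale k (iter n (F (- 1) c) p).
  by rewrite aE bE iter_F_scale// ltW.
exists [set p | Gamma a b p /\ exists n, exists2 v, v \in V & iter n (F a b) p = scale k v].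
split.
- by move=> p [].
- move=> _ /mapP[e ec ->].
  have [l [al [be [el m0]]]] := Vnull e (eq_ind_r (fun c' => e \in unit_edges c') ec cE).
  apply: (negligible_edge (A := fun t => (Gamma a b `\` _) (edge_point _ t)) _ el m0).
    by rewrite sqrtr_ge0.
  move=> t [Gt Et] n; apply/negP => nV; apply: Et; split => //; exists n.
  exists (iter n (F (- 1) c) (edge_point e t)) => //.
  by rewrite edge_point_scale ltr0_norm// iterE.
- apply: (card_le_nth (s := [seq omega_limit (F a b) (scale k v) | v <- V])).
    by rewrite size_map.
  move=> x [_ [n [v vV nx]]]; exists (index v V); first by rewrite size_map index_mem.
  by rewrite (nth_map v) ?index_mem// nth_index// -nx omega_limit_iter.
- move=> [q qE] x [_ [n [v vV nx]]].
  (* As [c = - q], the denominator of [q] also clears that of [c]. *)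
  have D0 : 0 < (denq q)%:~R :> R by rewrite ltr0z denq_gt0.
  have Dc : (denq q)%:~R * c \is a Num.int.
    rewrite cE mulNr qE /ratr mulrN rpredN mulrCA divff ?gt_eqF// mulr1.
    exact: intr_int.
  have [i [j [ij e]]] := Vper _ D0 (intr_int _ _) Dc v vV.
  rewrite -(omega_limit_iter _ x n) nx.
  apply: omega_limit_eventually_periodic; first exact: norm_hausdorff.
  by exists i, j; split => //; rewrite !iterE e.
Qed.

End reduction.

(** * The four directions of edges and the action of F on quadrants *)

Section lines.
Context (R : realType).

(* Parametrized by the abscissa, except [ver], parametrized by the ordinate. *)
Definition hor (y : R) : (R * R) * (R * R) := ((0, y), (1, 0)).
Definition ver (x : R) : (R * R) * (R * R) := ((x, 0), (0, 1)).
Definition diag (s : R) : (R * R) * (R * R) := ((0, s), (1, 1)).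
Definition anti (s : R) : (R * R) * (R * R) := ((0, s), (1, - 1)).

Lemma line_hor (y t : R) : line (hor y) t = (t, y).
Proof. by rewrite /line /=; congr pair; ring. Qed.

Lemma line_ver (x t : R) : line (ver x) t = (x, t).
Proof. by rewrite /line /=; congr pair; ring. Qed.

Lemma line_diag (s t : R) : line (diag s) t = (t, t + s).
Proof. by rewrite /line /=; congr pair; ring. Qed.

Lemma line_anti (s t : R) : line (anti s) t = (t, s - t).
Proof. by rewrite /line /=; congr pair; ring. Qed.

(** Here the image depends on [x - y] only, and in the third quadrant on [x + y] only; these are the
    sources of the collapses. *)
Lemma F_quadrant1 (a b x y : R) : 0 <= x -> 0 <= y ->
  F a b (x, y) = (x - y + a, x - y + b).
Proof. by move=> x0 y0; rewrite /F /= !ger0_norm. Qed.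

Lemma F_quadrant2 (a b x y : R) : x <= 0 -> 0 <= y ->
  F a b (x, y) = (- x - y + a, x - y + b).
Proof. by move=> x0 y0; rewrite /F /= ler0_norm// ger0_norm. Qed.

Lemma F_quadrant3 (a b x y : R) : x <= 0 -> y <= 0 ->
  F a b (x, y) = (- x - y + a, x + y + b).
Proof. by move=> x0 y0; rewrite /F /= !ler0_norm// opprK. Qed.

Lemma F_quadrant4 (a b x y : R) : 0 <= x -> y <= 0 ->
  F a b (x, y) = (x - y + a, x + y + b).
Proof. by move=> x0 y0; rewrite /F /= ger0_norm// ler0_norm// opprK. Qed.

(** The factor is a positive [r] instead of an absolute value, so that the resulting inequalities
    are linear with numeral coefficients; the sign of [k] only records orientation. *)
Lemma mass_expand (c : R) (V : seq (R * R)) l (al be : R) l' (al' be' k d r : R) :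
  0 < r -> k = r \/ k = - r ->
  (forall t, al <= t <= be ->
    F (- 1) c (line l t) = line l' (k * t + d) /\ al' <= k * t + d <= be') ->
  r * mass (- 1) c V l al be <= mass (- 1) c V l' al' be'.
Proof.
move=> r0 kr H.
have rE : `|k| = r by case: kr => ->; rewrite ?normrN gtr0_norm.
by rewrite -rE; apply: mass_affine H; rewrite -normr_gt0 rE.
Qed.

(** A collapsed arc need not land in [V] at once: its value [v] may reach [V] only [n] steps
    later. *)
Lemma mass_absorb (c : R) (V : seq (R * R)) l (al be : R) (v : R * R) n :
  iter n (F (- 1) c) v \in V ->
  (forall t, al <= t <= be -> F (- 1) c (line l t) = v) ->
  mass (- 1) c V l al be = 0.
Proof. by move=> vV H; apply: mass_eq0 => t /H e; exists n.+1; rewrite iterSr e. Qed.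

Lemma lattice_affine (D c : R) (m n p q : int) :
  D \is a Num.int -> D * c \is a Num.int ->
  lattice D (m%:~R * c + n%:~R, p%:~R * c + q%:~R).
Proof.
move=> iD iDc; split; rewrite /= mulrDr mulrCA rpredD//; apply: rpredM => //;
  exact: intr_int.
Qed.

End lines.

Ltac line_simpl := rewrite ?line_hor ?line_ver ?line_diag ?line_anti.

Ltac eval_F lem := line_simpl; rewrite lem; [congr pair; lra | lra | lra].

Ltac intro_itv :=
  let t := fresh "t" in let h1 := fresh "h" in let h2 := fresh "h" in
  move=> t /andP[h1 h2].

(** [lem] is the affine formula on the quadrant containing the arc; [k0] and [d0] are the slope and
    offset of the coordinate of the image. *)
Ltac expand h lem k0 d0 :=
  apply: (@mass_expand _ _ _ _ _ _ _ _ _ k0 d0); clear - h;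
    [lra | first [left; lra | right; lra]
    | intro_itv; split; [eval_F lem | lra]].

Ltac absorb h lem v0 :=
  apply: (@mass_absorb _ _ _ _ _ _ v0 0%N); clear - h;
    [rewrite /= ?inE ?eqxx ?orbT | intro_itv; eval_F lem].

(** Arcs are addressed by index, so that invariance of their union becomes one computation per arc
    and quadrant: [goto] names the index and the coordinate of the image. *)
Definition on_arcs (R : realType) (arcs : seq ((R * R) * (R * R) * (R * R)))
    (p : R * R) : Prop :=
  exists i t, [/\ (i < size arcs)%N, (arcs`_i).2.1 <= t <= (arcs`_i).2.2
                & p = line (arcs`_i).1 t].

Ltac goto lem i0 t0 :=
  exists i0, t0; split; [by [] | rewrite /=; lra | rewrite [RHS]/=; eval_F lem].

Ltac edge h l0 al0 be0 z :=
  exists l0, al0, be0; split; [clear - h; split; [lra|]; line_simpl;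
    first [left; congr pair; congr pair; lra | right; congr pair; congr pair; lra] | exact: z].

Ltac split_in :=
  match goal with
  | |- is_true (_ || _) -> _ => move=> /orP[/eqP-> |]; [|split_in]
  | _ => move/eqP->
  end.

(** * The range c < -2 *)

Lemma mass_edges_i (R : realType) (c : R) (hc : c < - 2) (e : edge R) :
  e \in edges_i c -> exists l al be,
  arc_of_edge l al be e /\ mass (- 1) c [:: (- c - 2, - 1)] l al be = 0.
Proof.
pose N := mass (- 1) c [:: (- c - 2, - 1)].
have N0 l al be : 0 <= N l al be by exact: mass_ge0.
have e1 : 1 * N (ver (- c - 2)) (- 3) (- 1) <= N (anti (- c - 5)) (- c - 2) (- c).
  by expand hc F_quadrant4 (- 1 : R) (- c - 3).
have e2 : 2 * N (anti (- c - 5)) (- c - 2) (- c) <= N (hor (- 5)) (- c) (- c + 4).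
  by expand hc F_quadrant4 (2 : R) (c + 4).
have e3 : 1 * N (hor (- 5)) (- c) (- c + 4) <= N (diag (c - 9)) (4 - c) (8 - c).
  by expand hc F_quadrant4 (1 : R) (4 : R).
have e4 : 2 * N (diag (c - 9)) (4 - c) (8 - c) <= N (ver (8 - c)) (- 1) 7.
  by expand hc F_quadrant4 (2 : R) (2 * c - 9).
have e5 : N (ver (8 - c)) (- 1) 7 <= N (ver (8 - c)) (- 1) 0 + N (ver (8 - c)) 0 7.
  exact: mass_split.
have e6 : 1 * N (ver (8 - c)) (- 1) 0 <= N (anti (15 - c)) (7 - c) (8 - c).
  by expand hc F_quadrant4 (- 1 : R) (7 - c).
have e7 : 1 * N (ver (8 - c)) 0 7 <= N (diag (c + 1)) (- c - 1) (7 - c).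
  by expand hc F_quadrant1 (- 1 : R) (7 - c).
have e8 : 2 * N (anti (15 - c)) (7 - c) (8 - c) <= N (diag (c + 1)) (- c - 2) (7 - c).
  by expand hc F_quadrant1 (2 : R) (c - 16).
have e9 : N (diag (c + 1)) (- c - 2) (7 - c) <=
    N (diag (c + 1)) (- c - 2) (- c - 1) + N (diag (c + 1)) (- c - 1) (7 - c).
  exact: mass_split.
have e10 : 2 * N (diag (c + 1)) (- c - 2) (- c - 1) <= N (ver (- c - 2)) (- 3) (- 1).
  by expand hc F_quadrant4 (2 : R) (2 * c + 1).
have e11 : N (diag (c + 1)) (- c - 1) (7 - c) = 0.
  by absorb hc F_quadrant1 (- c - 2, - 1 : R).
(* From here on the masses are opaque nonnegative numbers. With m the mass of P1 P2, the
   inequalities once around the cycle give 16 m <= m. *)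
rewrite -/N; clearbody N.
have z0 : N (ver (- c - 2)) (- 3) (- 1) = 0.
  by move: e1 e2 e3 e4 e5 e6 e7 e8 e9 e10 e11 (N0 (ver (- c - 2)) (- 3) (- 1)); clear; lra.
have z6 : N (diag (c + 1)) (- c - 2) (7 - c) = 0.
  by move: e9 e10 e11 z0 (N0 (diag (c + 1)) (- c - 2) (7 - c)); clear; lra.
(* The other edges follow backwards along the cycle, each mass being bounded by those of the
   images. *)
have z5 : N (anti (15 - c)) (7 - c) (8 - c) = 0.
  by move: e8 z6 (N0 (anti (15 - c)) (7 - c) (8 - c)); clear; lra.
have z4 : N (ver (8 - c)) (- 1) 7 = 0.
  by move: e5 e6 e7 e11 z5 (N0 (ver (8 - c)) (- 1) 7); clear; lra.
have z3 : N (diag (c - 9)) (4 - c) (8 - c) = 0.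
  by move: e4 z4 (N0 (diag (c - 9)) (4 - c) (8 - c)); clear; lra.
have z2 : N (hor (- 5)) (- c) (- c + 4) = 0.
  by move: e3 z3 (N0 (hor (- 5)) (- c) (- c + 4)); clear; lra.
have z1 : N (anti (- c - 5)) (- c - 2) (- c) = 0.
  by move: e2 z2 (N0 (anti (- c - 5)) (- c - 2) (- c)); clear; lra.
rewrite /edges_i !inE.
split_in.
- edge hc (ver (- c - 2)) (- 3 : R) (- 1 : R) z0.
- edge hc (anti (- c - 5)) (- c - 2) (- c) z1.
- edge hc (hor (- 5 : R)) (- c) (- c + 4) z2.
- edge hc (diag (c - 9)) (4 - c) (8 - c) z3.
- edge hc (ver (8 - c)) (- 1 : R) (7 : R) z4.
- edge hc (anti (15 - c)) (7 - c) (8 - c) z5.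
- edge hc (diag (c + 1)) (- c - 2) (7 - c) z6.
Qed.

(** The point lies on the explicit cycle P1, ..., P6, [(- c, 1)]. *)
Lemma periodic_i (R : realType) (c : R) (hc : c < - 2) :
  eventually_periodic (F (- 1) c) (- c - 2, - 1).
Proof.
exists 0%N, 7%N; split => //; rewrite 7!iterS [iter 0 _ _]/=.
have -> : F (- 1) c (- c - 2, - 1) = (- c - 2, - 3) by eval_F F_quadrant4.
have -> : F (- 1) c (- c - 2, - 3) = (- c, - 5) by eval_F F_quadrant4.
have -> : F (- 1) c (- c, - 5) = (- c + 4, - 5) by eval_F F_quadrant4.
have -> : F (- 1) c (- c + 4, - 5) = (- c + 8, - 1) by eval_F F_quadrant4.
have -> : F (- 1) c (- c + 8, - 1) = (- c + 8, 7) by eval_F F_quadrant4.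
have -> : F (- 1) c (- c + 8, 7) = (- c, 1) by eval_F F_quadrant1.
by apply/esym; eval_F F_quadrant1.
Qed.

(** * The range around -13/16 *)

Definition arcs_ii (R : realType) (c : R) : seq ((R * R) * (R * R) * (R * R)) :=
  [:: (diag (c + 1), (- c - 2, - 5 * c - 1));
      (hor (- 1), (- c - 2, c));
      (anti (c - 1), (c, c + 2));
      (hor (2 * c - 1), (- c, c + 4));
      (diag (5 * c - 1), (- 3 * c, 4 - c));
      (ver (- 5 * c), (- 1, 4 * c + 7));
      (anti (- 9 * c - 1), (- 5 * c - 1, - 5 * c))].

Lemma F_arcs_ii (R : realType) (c : R) (hc : - 1 < c <= - (3 / 4)) p :
  on_arcs (arcs_ii c) p -> on_arcs (arcs_ii c) (F (- 1) c p).
Proof.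
move=> [i [t [ilt ht ->]]].
case: i ilt ht => [|[|[|[|[|[|[|//]]]]]]] _ ht; rewrite [arcs_ii c]/arcs_ii /= in ht *.
- have [t0|/ltW t0] := leP t 0; last by goto F_quadrant1 1%N (- c - 2).
  have [t1|/ltW t1] := leP t (- c - 1); first by goto F_quadrant3 2%N (- 2 * t - c - 2).
  by goto F_quadrant2 1%N (- 2 * t - c - 2).
- by goto F_quadrant3 2%N (- t).
- have [t0|/ltW t0] := leP t 0; first by goto F_quadrant3 3%N (- c).
  by goto F_quadrant4 3%N (2 * t - c).
- by goto F_quadrant4 4%N (t - 2 * c).
- by goto F_quadrant4 5%N (2 * t + 6 * c - 1).
- have [t0|/ltW t0] := leP t 0; first by goto F_quadrant4 6%N (- t - 5 * c - 1).
  by goto F_quadrant1 0%N (- t - 5 * c - 1).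
- by goto F_quadrant1 0%N (2 * t + 9 * c).
Qed.

Lemma bounded_arcs_ii (R : realType) (c : R) (hc : - 1 < c <= - (3 / 4)) p :
  on_arcs (arcs_ii c) p -> `|p.1| <= 10 /\ `|p.2| <= 10.
Proof.
move=> [i [t [ilt ht ->]]].
by case: i ilt ht => [|[|[|[|[|[|[|//]]]]]]] _ ht;
  rewrite [arcs_ii c]/arcs_ii /= in ht *; line_simpl; rewrite !ler_norml /=; split; lra.
Qed.

(* The points P2 and R3. *)
Definition collapse_points_ii (R : realType) (c : R) : seq (R * R) :=
  [:: (- c - 2, - 1); (- c, 2 * c - 1)].

Lemma mass_edges_ii (R : realType) (c : R) (hc : - 1 < c <= - (3 / 4))
    (e : edge R) : e \in edges_ii c -> exists l al be,
  arc_of_edge l al be e /\ mass (- 1) c (collapse_points_ii c) l al be = 0.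
Proof.
pose N := mass (- 1) c (collapse_points_ii c).
have N0 l al be : 0 <= N l al be by exact: mass_ge0.
have s0 := mass_split (- 1) c (collapse_points_ii c) (diag (c + 1)) (- c - 2) 0 (- 5 * c - 1).
have s1 := mass_split (- 1) c (collapse_points_ii c) (diag (c + 1)) (- c - 2) (- c - 1) 0.
have s2 := mass_split (- 1) c (collapse_points_ii c) (anti (c - 1)) c 0 (c + 2).
have s3 := mass_split (- 1) c (collapse_points_ii c) (ver (- 5 * c)) (- 1) 0 (4 * c + 7).
rewrite -/N in s0 s1 s2 s3.
have e1 : N (diag (c + 1)) 0 (- 5 * c - 1) = 0.
  by absorb hc F_quadrant1 (- c - 2, - 1 : R).
have e2 : 2 * N (diag (c + 1)) (- c - 2) (- c - 1) <= N (anti (c - 1)) c (c + 2).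
  by expand hc F_quadrant3 (- 2 : R) (- c - 2).
have e3 : 2 * N (diag (c + 1)) (- c - 1) 0 <= N (hor (- 1)) (- c - 2) c.
  by expand hc F_quadrant2 (- 2 : R) (- c - 2).
have e4 : 1 * N (hor (- 1)) (- c - 2) c <= N (anti (c - 1)) 0 (c + 2).
  by expand hc F_quadrant3 (- 1 : R) (0 : R).
have e5 : N (anti (c - 1)) c 0 = 0.
  by absorb hc F_quadrant3 (- c, 2 * c - 1).
have e6 : 2 * N (anti (c - 1)) 0 (c + 2) <= N (hor (2 * c - 1)) (- c) (c + 4).
  by expand hc F_quadrant4 (2 : R) (- c).
have e7 : 1 * N (hor (2 * c - 1)) (- c) (c + 4) <= N (diag (5 * c - 1)) (- 3 * c) (4 - c).
  by expand hc F_quadrant4 (1 : R) (- 2 * c).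
have e8 : 2 * N (diag (5 * c - 1)) (- 3 * c) (4 - c) <= N (ver (- 5 * c)) (- 1) (4 * c + 7).
  by expand hc F_quadrant4 (2 : R) (6 * c - 1).
have e9 : 1 * N (ver (- 5 * c)) (- 1) 0 <= N (anti (- 9 * c - 1)) (- 5 * c - 1) (- 5 * c).
  by expand hc F_quadrant4 (- 1 : R) (- 5 * c - 1).
have e10 : 1 * N (ver (- 5 * c)) 0 (4 * c + 7) <= N (diag (c + 1)) (- c - 2) (- 5 * c - 1).
  by expand hc F_quadrant1 (- 1 : R) (- 5 * c - 1).
have e11 : 2 * N (anti (- 9 * c - 1)) (- 5 * c - 1) (- 5 * c) <=
    N (diag (c + 1)) (- c - 2) (- 5 * c - 1).
  by expand hc F_quadrant1 (2 : R) (9 * c).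
rewrite -/N; clearbody N.
(* Let D be the mass of P2 T2 and A that of the part of R2 P3 in x >= 0. The images of P2 T2 give D
   <= A, and following A around to P2 T2 gives 4 A <= 3 D / 2, so both vanish. *)
have z0 : N (diag (c + 1)) (- c - 2) (- 5 * c - 1) = 0.
  by move: s0 s1 s2 s3 e1 e2 e3 e4 e5 e6 e7 e8 e9 e10 e11 (N0 (diag (c + 1)) (- c - 2) (- 5 * c - 1)); clear; lra.
have z6 : N (anti (- 9 * c - 1)) (- 5 * c - 1) (- 5 * c) = 0.
  by move: e11 z0 (N0 (anti (- 9 * c - 1)) (- 5 * c - 1) (- 5 * c)); clear; lra.
have z5 : N (ver (- 5 * c)) (- 1) (4 * c + 7) = 0.
  by move: s3 e9 e10 z6 z0 (N0 (ver (- 5 * c)) (- 1) (4 * c + 7)); clear; lra.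
have z4 : N (diag (5 * c - 1)) (- 3 * c) (4 - c) = 0.
  by move: e8 z5 (N0 (diag (5 * c - 1)) (- 3 * c) (4 - c)); clear; lra.
have z3 : N (hor (2 * c - 1)) (- c) (c + 4) = 0.
  by move: e7 z4 (N0 (hor (2 * c - 1)) (- c) (c + 4)); clear; lra.
have z2 : N (anti (c - 1)) c (c + 2) = 0.
  by move: s2 e5 e6 z3 (N0 (anti (c - 1)) c (c + 2)); clear; lra.
have z1 : N (hor (- 1)) (- c - 2) c = 0.
  by move: s2 e4 e5 e6 z3 (N0 (hor (- 1)) (- c - 2) c); clear; lra.
rewrite /edges_ii !inE; split_in.
- edge hc (diag (c + 1)) (- c - 2) (- 5 * c - 1) z0.
- edge hc (hor (- 1 : R)) (- c - 2) c z1.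
- edge hc (anti (c - 1)) c (c + 2) z2.
- edge hc (hor (2 * c - 1)) (- c) (c + 4) z3.
- edge hc (diag (5 * c - 1)) (- 3 * c) (4 - c) z4.
- edge hc (ver (- 5 * c)) (- 1 : R) (4 * c + 7) z5.
- edge hc (anti (- 9 * c - 1)) (- 5 * c - 1) (- 5 * c) z6.
Qed.

Lemma periodic_ii (R : realType) (c D : R) (hc : - 1 < c <= - (3 / 4)) :
  0 < D -> D \is a Num.int -> D * c \is a Num.int ->
  forall v, v \in collapse_points_ii c -> eventually_periodic (F (- 1) c) v.
Proof.
move=> D0 iD iDc v; have iD' : D * - 1 \is a Num.int by rewrite mulrN1 rpredN.
rewrite !inE => /orP[]/eqP->; apply: (rational_orbit_eventually_periodic D0 iD' iDc
  (@F_arcs_ii _ c hc) (@bounded_arcs_ii _ c hc)).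
(* The goals alternate: each point is in the lattice, then on an arc. P2 is the left end of arc 1
   and R3 that of arc 3. *)
- have := lattice_affine (- 1) (- 2) 0 (- 1) iD iDc; congr lattice; congr pair; ring.
- by exists 1%N, (- c - 2); split=> //=; [lra|line_simpl].
- have := lattice_affine (- 1) 0 2 (- 1) iD iDc; congr lattice; congr pair; ring.
- by exists 3%N, (- c); split=> //=; [lra|line_simpl].
Qed.

(** * The range around 563/816 *)

Definition arcs_iii (R : realType) (c : R) : seq ((R * R) * (R * R) * (R * R)) :=
  [:: (diag (c + 1), (- 2 * c, 4 - c));
      (hor (- 1), (- c - 2, 3 * c - 2));
      (anti (c - 1), (- c, c + 2));
      (diag (c - 1), (0, 3 * c - 2));
      (hor (2 * c - 1), (- c, c + 4));
      (ver (- c), (1 - 2 * c, 8 * c - 5));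
      (anti (1 - 3 * c), (- 2 * c, - c));
      (diag (1 - c), (4 - 7 * c, c - 1));
      (ver (3 * c - 2), (- 1, 1 - 2 * c));
      (anti (7 * c - 5), (5 * c - 4, 3 * c - 2));
      (hor (8 * c - 5), (4 - 7 * c, - c));
      (ver (4 - 7 * c), (4 * c - 3, 8 * c - 5));
      (anti (9 - 15 * c), (4 - 7 * c, - c));
      (diag (9 - 13 * c), (- c, 7 * c - 5))].

(** The bounds on [c] give [3 * c - 2 > 0] and [7 * c - 5 <= 0], which decide the quadrants of
    several arcs. *)
Lemma F_arcs_iii (R : realType) (c : R) (hc : 2 / 3 < c <= 5 / 7) p :
  on_arcs (arcs_iii c) p -> on_arcs (arcs_iii c) (F (- 1) c p).
Proof.
move=> [i [t [ilt ht ->]]].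
case: i ilt ht => [|[|[|[|[|[|[|[|[|[|[|[|[|[|//]]]]]]]]]]]]]] _ ht;
  rewrite [arcs_iii c]/arcs_iii /= in ht *.
- have [t0|/ltW t0] := leP t 0; last by goto F_quadrant1 1%N (- c - 2).
  by goto F_quadrant2 1%N (- 2 * t - c - 2).
- have [t0|/ltW t0] := leP t 0; first by goto F_quadrant3 2%N (- t).
  by goto F_quadrant4 3%N t.
(* P2 X3 crosses three quadrants; its part in the third collapses to X3. *)
- have [t0|/ltW t0] := leP t 0; last by goto F_quadrant4 4%N (2 * t - c).
  have [t1|/ltW t1] := leP t (c - 1); first by goto F_quadrant2 5%N (2 * t + 1).
  by goto F_quadrant3 4%N (- c).
- by goto F_quadrant4 5%N (2 * t + 2 * c - 1).
- have [t0|/ltW t0] := leP t 0; first by goto F_quadrant2 6%N (- t - 2 * c).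
  by goto F_quadrant1 0%N (t - 2 * c).
- have [t0|/ltW t0] := leP t 0; first by goto F_quadrant3 2%N (c - 1 - t).
  by goto F_quadrant2 7%N (c - 1 - t).
- have [t0|/ltW t0] := leP t (1 - 3 * c).
    by goto F_quadrant2 8%N (2 * t + 4 * c - 1).
  by goto F_quadrant3 8%N (1 - 2 * c).
- by goto F_quadrant3 2%N (- 2 * t + c - 2).
- by goto F_quadrant4 9%N (3 * c - 3 - t).
- have [t0|/ltW t0] := leP t 0; last by goto F_quadrant4 10%N (2 * t - 7 * c + 4).
  have [t1|/ltW t1] := leP t (7 * c - 5); last by goto F_quadrant3 11%N (8 * c - 5).
  by goto F_quadrant2 11%N (2 * t - 6 * c + 5).
- by goto F_quadrant2 12%N (- t - 8 * c + 4).
- have [t0|/ltW t0] := leP t 0; first by goto F_quadrant3 2%N (7 * c - 5 - t).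
  by goto F_quadrant2 13%N (7 * c - 5 - t).
- by goto F_quadrant3 2%N (15 * c - 10).
- by goto F_quadrant3 2%N (- 2 * t + 13 * c - 10).
Qed.

Lemma bounded_arcs_iii (R : realType) (c : R) (hc : 2 / 3 < c <= 5 / 7) p :
  on_arcs (arcs_iii c) p -> `|p.1| <= 10 /\ `|p.2| <= 10.
Proof.
move=> [i [t [ilt ht ->]]].
by case: i ilt ht => [|[|[|[|[|[|[|[|[|[|[|[|[|[|//]]]]]]]]]]]]]] _ ht;
  rewrite [arcs_iii c]/arcs_iii /= in ht *; line_simpl; rewrite !ler_norml /=; split; lra.
Qed.

(* The points P1, X5 and F (Z3). *)
Definition collapse_points_iii (R : realType) (c : R) : seq (R * R) :=
  [:: (- c - 2, - 1); (3 * c - 2, 1 - 2 * c); (15 * c - 10, 9 - 14 * c)].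

Lemma mass_edges_iii (R : realType) (c : R) (hc : 2 / 3 < c <= 5 / 7)
    (e : edge R) : e \in edges_iii c -> exists l al be,
  arc_of_edge l al be e /\ mass (- 1) c (collapse_points_iii c) l al be = 0.
Proof.
pose N := mass (- 1) c (collapse_points_iii c).
have N0 l al be : 0 <= N l al be by exact: mass_ge0.
have split_at l al ga be : N l al be <= N l al ga + N l ga be by exact: mass_split.
(* The number in a name [s], [e] or [z] is the position of the edge in [edges_iii]. *)
have s0 := split_at (diag (c + 1)) (- 2 * c) 0 (4 - c).
have e0 : N (diag (c + 1)) 0 (4 - c) = 0.
  by absorb hc F_quadrant1 (- c - 2, - 1 : R).
have e0' : 2 * N (diag (c + 1)) (- 2 * c) 0 <= N (hor (- 1)) (- c - 2) (3 * c - 2).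
  by expand hc F_quadrant2 (- 2 : R) (- c - 2).
have s1 := split_at (hor (- 1)) (- c - 2) 0 (3 * c - 2).
have e1 : 1 * N (hor (- 1)) (- c - 2) 0 <= N (anti (c - 1)) 0 (c + 2).
  by expand hc F_quadrant3 (- 1 : R) (0 : R).
have e1' : 1 * N (hor (- 1)) 0 (3 * c - 2) <= N (diag (c - 1)) 0 (3 * c - 2).
  by expand hc F_quadrant4 (1 : R) (0 : R).
have s2 := split_at (anti (c - 1)) (- c) (c - 1) (c + 2).
have s2' := split_at (anti (c - 1)) (c - 1) 0 (c + 2).
have e2 : N (anti (c - 1)) (c - 1) 0 = 0.
  (* This part collapses to X3, which F maps to X4 and then to X5. *)
  apply: (@mass_absorb _ _ _ _ _ _ (- c, 2 * c - 1) 2); last first.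
    by clear - hc; intro_itv; eval_F F_quadrant3.
  clear - hc; rewrite 2!iterS [iter 0 _ _]/=.
  have -> : F (- 1) c (- c, 2 * c - 1) = (- c, 1 - 2 * c) by eval_F F_quadrant2.
  have -> : F (- 1) c (- c, 1 - 2 * c) = (3 * c - 2, 1 - 2 * c) by eval_F F_quadrant3.
  by rewrite !inE eqxx orbT.
have e2' : 2 * N (anti (c - 1)) 0 (c + 2) <= N (hor (2 * c - 1)) (- c) (c + 4).
  by expand hc F_quadrant4 (2 : R) (- c).
have e2'' : 2 * N (anti (c - 1)) (- c) (c - 1) <= N (ver (- c)) (1 - 2 * c) (8 * c - 5).
  by expand hc F_quadrant2 (2 : R) (1 : R).
have e3 : 2 * N (diag (c - 1)) 0 (3 * c - 2) <= N (ver (- c)) 0 (8 * c - 5).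
  by expand hc F_quadrant4 (2 : R) (2 * c - 1).
have s4 := split_at (hor (2 * c - 1)) (- c) 0 (c + 4).
have e4 : 1 * N (hor (2 * c - 1)) (- c) 0 <= N (anti (1 - 3 * c)) (- 2 * c) (- c).
  by expand hc F_quadrant2 (- 1 : R) (- 2 * c).
have e4' : 1 * N (hor (2 * c - 1)) 0 (c + 4) <= N (diag (c + 1)) (- 2 * c) (4 - c).
  by expand hc F_quadrant1 (1 : R) (- 2 * c).
have s5 := split_at (ver (- c)) (1 - 2 * c) 0 (8 * c - 5).
(* The target stops at abscissa [c - 1]: by [s2'] and [e2] its mass is at most that of the part of
   P2 X3 in x >= 0, a sharper bound than the whole edge. *)
have e5 : 1 * N (ver (- c)) (1 - 2 * c) 0 <= N (anti (c - 1)) (c - 1) (c + 2).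
  by expand hc F_quadrant3 (- 1 : R) (c - 1).
have e5' : 1 * N (ver (- c)) 0 (8 * c - 5) <= N (diag (1 - c)) (4 - 7 * c) (c - 1).
  by expand hc F_quadrant2 (- 1 : R) (c - 1).
have s6 := split_at (anti (1 - 3 * c)) (- 2 * c) (1 - 3 * c) (- c).
have e6 : N (anti (1 - 3 * c)) (1 - 3 * c) (- c) = 0.
  by absorb hc F_quadrant3 (3 * c - 2, 1 - 2 * c).
have e6' : 2 * N (anti (1 - 3 * c)) (- 2 * c) (1 - 3 * c) <=
    N (ver (3 * c - 2)) (- 1) (1 - 2 * c).
  by expand hc F_quadrant2 (2 : R) (4 * c - 1).
have e7 : 2 * N (diag (1 - c)) (4 - 7 * c) (c - 1) <= N (anti (c - 1)) (- c) (c + 2).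
  by expand hc F_quadrant3 (- 2 : R) (c - 2).
have e8 : 1 * N (ver (3 * c - 2)) (- 1) (1 - 2 * c) <=
    N (anti (7 * c - 5)) (5 * c - 4) (3 * c - 2).
  by expand hc F_quadrant4 (- 1 : R) (3 * c - 3).
have s9 := split_at (anti (7 * c - 5)) (5 * c - 4) (7 * c - 5) (3 * c - 2).
have s9' := split_at (anti (7 * c - 5)) (7 * c - 5) 0 (3 * c - 2).
have e9 : N (anti (7 * c - 5)) (7 * c - 5) 0 = 0.
  (* This part collapses to Z2, which F maps to Z3 and then to F (Z3). *)
  apply: (@mass_absorb _ _ _ _ _ _ (4 - 7 * c, 8 * c - 5) 2); last first.
    by clear - hc; intro_itv; eval_F F_quadrant3.
  clear - hc; rewrite 2!iterS [iter 0 _ _]/=.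
  have -> : F (- 1) c (4 - 7 * c, 8 * c - 5) = (- c, 9 - 14 * c) by eval_F F_quadrant2.
  have -> : F (- 1) c (- c, 9 - 14 * c) = (15 * c - 10, 9 - 14 * c) by eval_F F_quadrant3.
  by rewrite !inE eqxx !orbT.
have e9' : 2 * N (anti (7 * c - 5)) 0 (3 * c - 2) <= N (hor (8 * c - 5)) (4 - 7 * c) (- c).
  by expand hc F_quadrant4 (2 : R) (4 - 7 * c).
have e9'' : 2 * N (anti (7 * c - 5)) (5 * c - 4) (7 * c - 5) <=
    N (ver (4 - 7 * c)) (4 * c - 3) (8 * c - 5).
  by expand hc F_quadrant2 (2 : R) (5 - 6 * c).
have e10 : 1 * N (hor (8 * c - 5)) (4 - 7 * c) (- c) <=
    N (anti (9 - 15 * c)) (4 - 7 * c) (- c).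
  by expand hc F_quadrant2 (- 1 : R) (4 - 8 * c).
have s11 := split_at (ver (4 - 7 * c)) (4 * c - 3) 0 (8 * c - 5).
have e11 : 1 * N (ver (4 - 7 * c)) (4 * c - 3) 0 <= N (anti (c - 1)) (c - 1) (c + 2).
  by expand hc F_quadrant3 (- 1 : R) (7 * c - 5).
have e11' : 1 * N (ver (4 - 7 * c)) 0 (8 * c - 5) <= N (diag (9 - 13 * c)) (- c) (7 * c - 5).
  by expand hc F_quadrant2 (- 1 : R) (7 * c - 5).
have e12 : N (anti (9 - 15 * c)) (4 - 7 * c) (- c) = 0.
  by absorb hc F_quadrant3 (15 * c - 10, 9 - 14 * c).
have e13 : 2 * N (diag (9 - 13 * c)) (- c) (7 * c - 5) <= N (anti (c - 1)) (- c) (c + 2).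
  by expand hc F_quadrant3 (- 2 : R) (13 * c - 10).
rewrite -/N; clearbody N.
have nR := N0 (anti (c - 1)) 0 (c + 2); have nL := N0 (anti (c - 1)) (- c) (c - 1).
(* Write L and R for the masses of the parts x <= c - 1 and 0 <= x of the edge
   P2 X3. Following their images back to this edge gives L <= R and
   2 R <= 5 R / 4. *)
have [R0 L0] : N (anti (c - 1)) 0 (c + 2) = 0 /\ N (anti (c - 1)) (- c) (c - 1) = 0.
  by clear N0 split_at hc; split; lra.
clear nR nL.
(* Each further mass is bounded, by following images, by masses already known to vanish. *)
have z2 : N (anti (c - 1)) (- c) (c + 2) = 0.
  by move: s2 s2' e2 L0 R0 (N0 (anti (c - 1)) (- c) (c + 2)); clear; lra.
have z7 : N (diag (1 - c)) (4 - 7 * c) (c - 1) = 0.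
  by move: e7 z2 (N0 (diag (1 - c)) (4 - 7 * c) (c - 1)); clear; lra.
have z3 : N (diag (c - 1)) 0 (3 * c - 2) = 0.
  by move: e3 e5' z7 (N0 (diag (c - 1)) 0 (3 * c - 2)); clear; lra.
have z5 : N (ver (- c)) (1 - 2 * c) (8 * c - 5) = 0.
  by move: s5 s2' e2 R0 e5 e5' z7 (N0 (ver (- c)) (1 - 2 * c) (8 * c - 5)); clear; lra.
have z13 : N (diag (9 - 13 * c)) (- c) (7 * c - 5) = 0.
  by move: e13 z2 (N0 (diag (9 - 13 * c)) (- c) (7 * c - 5)); clear; lra.
have z11 : N (ver (4 - 7 * c)) (4 * c - 3) (8 * c - 5) = 0.
  by move: s11 s2' e2 R0 e11 e11' z13 (N0 (ver (4 - 7 * c)) (4 * c - 3) (8 * c - 5)); clear; lra.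
have z10 : N (hor (8 * c - 5)) (4 - 7 * c) (- c) = 0.
  by move: e10 e12 (N0 (hor (8 * c - 5)) (4 - 7 * c) (- c)); clear; lra.
have z9 : N (anti (7 * c - 5)) (5 * c - 4) (3 * c - 2) = 0.
  by move: s9 s9' e9 e9' e9'' z10 z11 (N0 (anti (7 * c - 5)) (5 * c - 4) (3 * c - 2)); clear; lra.
have z8 : N (ver (3 * c - 2)) (- 1) (1 - 2 * c) = 0.
  by move: e8 z9 (N0 (ver (3 * c - 2)) (- 1) (1 - 2 * c)); clear; lra.
have z6 : N (anti (1 - 3 * c)) (- 2 * c) (- c) = 0.
  by move: s6 e6 e6' z8 (N0 (anti (1 - 3 * c)) (- 2 * c) (- c)); clear; lra.
have z1 : N (hor (- 1)) (- c - 2) (3 * c - 2) = 0.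
  by move: s1 e1 e1' R0 z3 (N0 (hor (- 1)) (- c - 2) (3 * c - 2)); clear; lra.
have z0 : N (diag (c + 1)) (- 2 * c) (4 - c) = 0.
  by move: s0 e0 e0' z1 (N0 (diag (c + 1)) (- 2 * c) (4 - c)); clear; lra.
have z4 : N (hor (2 * c - 1)) (- c) (c + 4) = 0.
  by move: s4 e4 e4' z6 z0 (N0 (hor (2 * c - 1)) (- c) (c + 4)); clear; lra.
rewrite /edges_iii !inE; split_in.
- edge hc (diag (c + 1)) (- 2 * c) (4 - c) z0.
- edge hc (hor (- 1 : R)) (- c - 2) (3 * c - 2) z1.
- edge hc (anti (c - 1)) (- c) (c + 2) z2.
- edge hc (diag (c - 1)) (0 : R) (3 * c - 2) z3.
- edge hc (hor (2 * c - 1)) (- c) (c + 4) z4.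
- edge hc (ver (- c)) (1 - 2 * c) (8 * c - 5) z5.
- edge hc (anti (1 - 3 * c)) (- 2 * c) (- c) z6.
- edge hc (diag (1 - c)) (4 - 7 * c) (c - 1) z7.
- edge hc (ver (3 * c - 2)) (- 1 : R) (1 - 2 * c) z8.
- edge hc (anti (7 * c - 5)) (5 * c - 4) (3 * c - 2) z9.
- edge hc (hor (8 * c - 5)) (4 - 7 * c) (- c) z10.
- edge hc (ver (4 - 7 * c)) (4 * c - 3) (8 * c - 5) z11.
- edge hc (anti (9 - 15 * c)) (4 - 7 * c) (- c) e12.
- edge hc (diag (9 - 13 * c)) (- c) (7 * c - 5) z13.
Qed.

Lemma periodic_iii (R : realType) (c D : R) (hc : 2 / 3 < c <= 5 / 7) :
  0 < D -> D \is a Num.int -> D * c \is a Num.int ->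
  forall v, v \in collapse_points_iii c -> eventually_periodic (F (- 1) c) v.
Proof.
move=> D0 iD iDc v; have iD' : D * - 1 \is a Num.int by rewrite mulrN1 rpredN.
rewrite !inE => /or3P[]/eqP->; apply: (rational_orbit_eventually_periodic D0 iD' iDc
  (@F_arcs_iii _ c hc) (@bounded_arcs_iii _ c hc)).
(* P1 is the left end of arc 1, X5 the upper end of arc 8, and F (Z3) an interior point of arc 2,
   the edge P2 X3. *)
- have := lattice_affine (- 1) (- 2) 0 (- 1) iD iDc; congr lattice; congr pair; ring.
- by exists 1%N, (- c - 2); split=> //=; [lra|line_simpl].
- have := lattice_affine 3 (- 2) (- 2) 1 iD iDc; congr lattice; congr pair; ring.
- by exists 8%N, (1 - 2 * c); split=> //=; [lra|line_simpl].
- have := lattice_affine 15 (- 10) (- 14) 9 iD iDc; congr lattice; congr pair; ring.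
- by exists 2%N, (15 * c - 10); split=> //=; [lra|line_simpl; congr pair; ring].
Qed.

(** * The three parameter ranges together *)

Theorem theorem3 (R : realType) (a b c : R) (ha : a < 0) (hc : c = - b / a)
    (hrange : c < - 2 \/ - (112 / 137) <= c <= - (13 / 16)
              \/ 603 / 874 <= c <= 563 / 816) :
  exists E : set (R * R),
    [/\ E `<=` Gamma a b,
        arc_length_null (Gamma_edges a b) (Gamma a b `\` E),
        [set omega_limit (F a b) x | x in E] #<= `I_3
      & (exists q : rat, b / a = ratr q) ->
        forall x : R * R, E x ->
          is_periodic_orbit (F a b) (omega_limit (F a b) x)].
Proof.
case: hrange => [ci|[cii|ciii]].
- apply: (theorem3_from_unit (V := [:: (- c - 2, - 1)]) ha hc) => //.
    by rewrite /unit_edges ci; exact: mass_edges_i.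
  by move=> D _ _ _ v; rewrite inE => /eqP->; exact: periodic_i.
(* The given interval lies in one with simpler endpoints on which all the quadrant inequalities
   hold. *)
- have hc' : - 1 < c <= - (3 / 4) by lra.
  apply: (theorem3_from_unit (V := collapse_points_ii c) ha hc) => //.
    by rewrite /unit_edges cii ifF; [exact: mass_edges_ii|lra].
  by move=> D; exact: periodic_ii.
- have hc' : 2 / 3 < c <= 5 / 7 by lra.
  apply: (theorem3_from_unit (V := collapse_points_iii c) ha hc) => //.
    by rewrite /unit_edges ciii !ifF; [exact: mass_edges_iii|lra|lra].
  by move=> D; exact: periodic_iii.
Qed.
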